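(* Let $V$ be a finite-dimensional irreducible $\mathcal O_q$-module of dimension at least $2$ on which the generators $A$ and $B$ are diagonalizable, let $L$ be the Lusztig automorphism of $\mathcal O_q$, and let $\Psi=\sum_{i=0}^d t_iE_i:V\to V$ be the map defined in the context. Then for all $X\in\mathcal O_q$ the following holds on $V$: $$L(X)=\Psi^{-1}X\Psi.$$
   Context: Let $\mathbb F$ be a field and fix $0\neq q\in\mathbb F$ that is not a root of unity. Algebras are associative with $1$. Write $[n]_q=(q^n-q^{-n})/(q-q^{-1})$. The $q$-Onsager algebra $\mathcal O_q$ is the $\mathbb F$-algebra with generators $A,B$ and relations $$A^3B-[3]_qA^2BA+[3]_qABA^2-BA^3=(q^2-q^{-2})^2(BA-AB),$$ $$B^3A-[3]_qB^2AB+[3]_qBAB^2-AB^3=(q^2-q^{-2})^2(AB-BA).$$ The Lusztig automorphism $L$ is the $\mathbb F$-algebra automorphism of $\mathcal O_q$ (found by Baseilhac and Kolb) that satisfies $$L(A)=A,\qquad L(B)=B+\frac{qA^2B-(q+q^{-1})ABA+q^{-1}BA^2}{(q-q^{-1})(q^2-q^{-2})},$$ $$L^{-1}(A)=A,\qquad L^{-1}(B)=B+\frac{q^{-1}A^2B-(q+q^{-1})ABA+qBA^2}{(q-q^{-1})(q^2-q^{-2})}.$$ Let $V$ be a finite-dimensional irreducible $\mathcal O_q$-module, of dimension at least $2$, on which $A$ and $B$ are diagonalizable (over $\mathbb F$). It is known that $A,B$ act on $V$ as a tridiagonal pair. Fix a standard ordering $\{\theta_i\}_{i=0}^d$ of the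 (mutually distinct) eigenvalues of $A$ on $V$: this means that, with $V_i$ the eigenspace of $A$ for $\theta_i$, one has $BV_i\subseteq V_{i-1}+V_i+V_{i+1}$ for $0\le i\le d$, where $V_{-1}=V_{d+1}=0$. Then $d\ge1$. For $0\le i\le d$ let $E_i:V\to V$ be the projection onto the eigenspace $V_i$ (along the sum of the other eigenspaces of $A$). It is known that there is a nonzero $a\in\mathbb F$ such that $\theta_i=aq^{d-2i}+a^{-1}q^{2i-d}$ for $0\le i\le d$. Define $$t_i=a^{2i}q^{2i(d-i)}\quad(0\le i\le d),\qquad \Psi=\sum_{i=0}^dt_iE_i.$$ The map $\Psi$ is invertible, with $\Psi^{-1}=\sum_{i=0}^dt_i^{-1}E_i$. ''Holds on $V$'' means that the two sides agree as linear maps on $V$, an element of $\mathcal O_q$ being identified with its action on $V$. *)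

(* Defs.v *)
From HB Require Import structures.
From mathcomp Require Import all_boot all_algebra boolp.
From mathcomp Require Import finmap monalg.

Set Implicit Arguments.
Unset Strict Implicit.
Unset Printing Implicit Defensive.

Import GRing.Theory.
Local Open Scope ring_scope.
Local Open Scope quotient_scope.

Record proper_two_sided_ideal (F : fieldType) (R : algType F) := TwoSidedIdeal {
  ideal_mem :> R -> Prop;
  ideal_mem0 : ideal_mem 0;
  ideal_memD : forall x y, ideal_mem x -> ideal_mem y -> ideal_mem (x + y);
  ideal_memM : forall u x v, ideal_mem x -> ideal_mem (u * x * v);
  ideal_mem1 : ~ ideal_mem 1
}.

Section AlgebraQuotient.
Variables (F : fieldType) (R : algType F) (I : proper_two_sided_ideal R).

Definition ideal_pred : {pred R} := [pred x | `[< I x >]].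

Lemma ideal_predP x : reflect (I x) (x \in ideal_pred).
Proof. exact: asboolP. Qed.

Lemma ideal_zmod_closed : zmod_closed ideal_pred.
Proof.
split; first by apply/ideal_predP; exact: ideal_mem0.
move=> x y /ideal_predP Ix /ideal_predP Iy; apply/ideal_predP.
by apply: ideal_memD => //; rewrite -[- y]mulr1 -mulN1r; exact: ideal_memM.
Qed.

HB.instance Definition _ := GRing.isZmodClosed.Build R ideal_pred
  ideal_zmod_closed.

Definition alg_quot : Type := Quotient.quot (ideal_pred : zmodClosed _).

HB.instance Definition _ := GRing.Zmodule.on alg_quot.
HB.instance Definition _ := EqQuotient.on alg_quot.

Lemma alg_quot_eqP (x y : R) :
  reflect (\pi_alg_quot x = \pi_alg_quot y) (x - y \in ideal_pred).
Proof. by rewrite Quotient.idealrBE; exact: eqP. Qed.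

Lemma repr_pi_sub (x : R) : repr (\pi_alg_quot x) - x \in ideal_pred.
Proof. by apply/alg_quot_eqP; rewrite reprK. Qed.

Definition aq_one : alg_quot := lift_cst alg_quot 1.
Definition aq_mul := lift_op2 alg_quot *%R.
Definition aq_scale (k : F) := lift_op1 alg_quot ( *:%R k).

Canonical pi_aq_one_morph := PiConst aq_one.

Lemma pi_aq_mul : {morph \pi : x y / x * y >-> aq_mul x y}.
Proof.
move=> x y; unlock aq_mul; apply/alg_quot_eqP.
set x' := repr _; set y' := repr _.
have -> : x * y - x' * y' = - ((x' - x) * y' + x * (y' - y)).
  by rewrite mulrBl mulrBr addrA subrK opprB.
rewrite rpredN rpredD //; apply/ideal_predP.
  by rewrite -[_ * y']mul1r mulrA; apply: ideal_memM; exact/ideal_predP/repr_pi_sub.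
by rewrite -[x * _]mulr1; apply: ideal_memM; exact/ideal_predP/repr_pi_sub.
Qed.
Canonical pi_aq_mul_morph := PiMorph2 pi_aq_mul.

Lemma pi_aq_scale k : {morph \pi : x / k *: x >-> aq_scale k x}.
Proof.
move=> x; unlock aq_scale; apply/esym/alg_quot_eqP.
rewrite -scalerBr -[_ - x]mul1r scalerAl -[_ * _]mulr1.
by apply/ideal_predP/ideal_memM/ideal_predP/repr_pi_sub.
Qed.
Canonical pi_aq_scale_morph k := PiMorph1 (pi_aq_scale k).

Lemma aq_mulA : associative aq_mul.
Proof. by move=> x y z; rewrite -[x]reprK -[y]reprK -[z]reprK !piE mulrA. Qed.

Lemma aq_mul1r : left_id aq_one aq_mul.
Proof. by move=> x; rewrite -[x]reprK !piE mul1r. Qed.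

Lemma aq_mulr1 : right_id aq_one aq_mul.
Proof. by move=> x; rewrite -[x]reprK !piE mulr1. Qed.

Lemma aq_mulDl : left_distributive aq_mul +%R.
Proof.
by move=> x y z; rewrite -[x]reprK -[y]reprK -[z]reprK !piE mulrDl.
Qed.

Lemma aq_mulDr : right_distributive aq_mul +%R.
Proof.
by move=> x y z; rewrite -[x]reprK -[y]reprK -[z]reprK !piE mulrDr.
Qed.

Lemma aq_one_neq0 : aq_one != 0.
Proof.
apply/eqP; rewrite !piE => /alg_quot_eqP; rewrite subr0 => /ideal_predP.
exact: ideal_mem1.
Qed.

HB.instance Definition _ := GRing.Zmodule_isNzRing.Build alg_quot
  aq_mulA aq_mul1r aq_mulr1 aq_mulDl aq_mulDr aq_one_neq0.

Lemma aq_scaleA a b x : aq_scale a (aq_scale b x) = aq_scale (a * b) x.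
Proof. by rewrite -[x]reprK !piE scalerA. Qed.

Lemma aq_scale1r : left_id 1 aq_scale.
Proof. by move=> x; rewrite -[x]reprK !piE scale1r. Qed.

Lemma aq_scaleDr : right_distributive aq_scale +%R.
Proof. by move=> k x y; rewrite -[x]reprK -[y]reprK !piE scalerDr. Qed.

Lemma aq_scaleDl x : {morph aq_scale^~ x : a b / a + b}.
Proof. by move=> a b; rewrite -[x]reprK !piE scalerDl. Qed.

HB.instance Definition _ := GRing.Zmodule_isLmodule.Build F alg_quot
  aq_scaleA aq_scale1r aq_scaleDr aq_scaleDl.

Lemma aq_scaleAl (k : F) (x y : alg_quot) : k *: (x * y) = (k *: x) * y.
Proof.
change (aq_scale k (aq_mul x y) = aq_mul (aq_scale k x) y).
by rewrite -[x]reprK -[y]reprK !piE scalerAl.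
Qed.

Lemma aq_scaleAr (k : F) (x y : alg_quot) : k *: (x * y) = x * (k *: y).
Proof.
change (aq_scale k (aq_mul x y) = aq_mul x (aq_scale k y)).
by rewrite -[x]reprK -[y]reprK !piE scalerAr.
Qed.

HB.instance Definition _ := GRing.Lmodule_isLalgebra.Build F alg_quot aq_scaleAl.
HB.instance Definition _ := GRing.Lalgebra_isAlgebra.Build F alg_quot aq_scaleAr.

Definition quot_proj (x : R) : alg_quot := \pi_alg_quot x.

Lemma quot_proj_monoid : monoid_morphism quot_proj.
Proof.
split=> [|x y]; last exact: pi_aq_mul.
by rewrite /quot_proj -[RHS]/aq_one piE.
Qed.

Lemma quot_proj_linear : linear quot_proj.
Proof.
move=> k x y; change (\pi_alg_quot (k *: x + y) =
  aq_scale k (\pi_alg_quot x) + \pi_alg_quot y).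
by rewrite !piE.
Qed.

HB.instance Definition _ := GRing.isLinear.Build F R alg_quot *:%R quot_proj
  quot_proj_linear.
HB.instance Definition _ := GRing.isMonoidMorphism.Build R alg_quot quot_proj
  quot_proj_monoid.

Lemma quot_proj_eq0 x : quot_proj x = 0 <-> I x.
Proof.
rewrite -(raddf0 quot_proj); split=> [/alg_quot_eqP/ideal_predP|Ix].
  by rewrite subr0.
by apply/alg_quot_eqP/ideal_predP; rewrite subr0.
Qed.

Lemma quot_projP (x : alg_quot) : exists y, quot_proj y = x.
Proof. by exists (repr x); exact: reprK. Qed.

End AlgebraQuotient.

Definition qint (F : fieldType) (q : F) (n : nat) : F :=
  (q ^+ n - q ^- n) / (q - q^-1).

(* The two defining relations of the q-Onsager algebra read
   qDG_lhs q A B = qDG_rhs q A B and qDG_lhs q B A = qDG_rhs q B A. *)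
Definition qDG_lhs (F : fieldType) (q : F) (R : algType F) (a b : R) : R :=
  a ^+ 3 * b - qint q 3 *: (a ^+ 2 * b * a)
  + qint q 3 *: (a * b * a ^+ 2) - b * a ^+ 3.

Definition qDG_rhs (F : fieldType) (q : F) (R : algType F) (a b : R) : R :=
  (q ^+ 2 - q ^- 2) ^+ 2 *: (b * a - a * b).

(* The free algebra on two generators, as the monoid algebra of the words over
   bool; the letters true and false stand for A and B. *)
Definition freeAB (F : fieldType) := {malg F[{fmonom bool}]}.
HB.instance Definition _ (F : fieldType) := GRing.Lalgebra.on (freeAB F).

Lemma malg_scaleAr (K : monomType) (R : comNzRingType) (k : R)
  (x y : {malg R[K]}) : k *: (x * y) = x * (k *: y).
Proof.
apply/malgP => m; rewrite mcoeffZ mcoeffMl.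
rewrite (mcoeffMlw _ (fsubset_refl _) (msuppZ_le k y)).
rewrite mulr_sumr; apply: eq_bigr => i _; rewrite mulr_sumr.
by apply: eq_bigr => j _; rewrite mcoeffZ mulrnAr mulrCA.
Qed.

HB.instance Definition _ (F : fieldType) :=
  GRing.Lalgebra_isAlgebra.Build F (freeAB F)
    (@malg_scaleAr {fmonom bool} F).

Definition freeA (F : fieldType) : freeAB F := << fmu true >>.
Definition freeB (F : fieldType) : freeAB F := << fmu false >>.
Arguments freeA {F}.
Arguments freeB {F}.

(* Membership in the two-sided ideal generated by the defining relations. *)
Inductive qOnsager_rel (F : fieldType) (q : F) : freeAB F -> Prop :=
| QO_relAB : qOnsager_rel q (qDG_lhs q freeA freeB - qDG_rhs q freeA freeB)
| QO_relBA : qOnsager_rel q (qDG_lhs q freeB freeA - qDG_rhs q freeB freeA)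
| QO_zero : qOnsager_rel q 0
| QO_add x y : qOnsager_rel q x -> qOnsager_rel q y -> qOnsager_rel q (x + y)
| QO_mul u x v : qOnsager_rel q x -> qOnsager_rel q (u * x * v).

Lemma qDG_augmentation (F : fieldType) (q : F) (R : algType F)
    (e : R -> F) (a b : R) :
    {morph e : x y / x - y} -> {morph e : x y / x * y} ->
    (forall k x, e (k *: x) = k * e x) -> e a = 0 -> e b = 0 ->
  e (qDG_lhs q a b - qDG_rhs q a b) = 0.
Proof.
move=> eB eM eZ a0 b0; have e0 : e 0 = 0 by rewrite -[0](subrr 0) eB subrr.
have eN x : e (- x) = - e x by rewrite -sub0r eB e0 sub0r.
have eD x y : e (x + y) = e x + e y by rewrite -{1}[y]opprK eB eN opprK.
by rewrite /qDG_lhs /qDG_rhs !(eB, eD, eZ, eM) a0 b0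
           !(mulr0, mul0r, subr0, addr0).
Qed.

Lemma qOnsager_rel_counit (F : fieldType) (q : F) (x : freeAB F) :
  qOnsager_rel q x -> mcoeff mone x = 0.
Proof.
have A0 : mcoeff mone (freeA : freeAB F) = 0 by rewrite mcoeffU1 fm1_eq1.
have B0 : mcoeff mone (freeB : freeAB F) = 0 by rewrite mcoeffU1 fm1_eq1.
have eM (y z : freeAB F) : mcoeff mone (y * z) = mcoeff mone y * mcoeff mone z.
  by have [eM _] := mcoeff1g_is_multiplicative {fmonom bool} F; exact: eM.
have rel0 (a b : freeAB F) : mcoeff mone a = 0 -> mcoeff mone b = 0 ->
    mcoeff mone (qDG_lhs q a b - qDG_rhs q a b) = 0.
  apply: (@qDG_augmentation _ _ (freeAB F) (mcoeff mone)) => //.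
  - by move=> y z; exact: mcoeffB.
  - by move=> k y; exact: mcoeffZ.
elim=> [|||y z _ y0 _ z0|u y v _ y0].
- exact: rel0.
- exact: rel0.
- exact: mcoeff0.
- by rewrite [LHS]mcoeffD y0 z0 addr0.
- by rewrite !eM y0 mulr0 mul0r.
Qed.

Lemma qOnsager_rel_proper (F : fieldType) (q : F) : ~ qOnsager_rel q 1.
Proof.
move/qOnsager_rel_counit; rewrite [LHS]mcoeff1 eqxx => /eqP.
by rewrite oner_eq0.
Qed.

Definition qOnsager_ideal (F : fieldType) (q : F) :
    proper_two_sided_ideal (freeAB F) :=
  TwoSidedIdeal (@QO_zero F q) (@QO_add F q) (@QO_mul F q)
    (@qOnsager_rel_proper F q).

Definition qOnsager (F : fieldType) (q : F) : Type :=
  alg_quot (qOnsager_ideal q).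
HB.instance Definition _ (F : fieldType) (q : F) :=
  GRing.Algebra.on (qOnsager q).

Definition qOA (F : fieldType) (q : F) : qOnsager q :=
  quot_proj (qOnsager_ideal q) freeA.
Definition qOB (F : fieldType) (q : F) : qOnsager q :=
  quot_proj (qOnsager_ideal q) freeB.

Section QOnsagerGenerators.
Variables (F : fieldType) (q : F).
Local Notation A := (qOA q).
Local Notation B := (qOB q).

Lemma qDG_morph (R S : algType F) (phi : {lrmorphism R -> S}) (x y : R) :
  phi (qDG_lhs q x y - qDG_rhs q x y) =
  qDG_lhs q (phi x) (phi y) - qDG_rhs q (phi x) (phi y).
Proof.
rewrite /qDG_lhs /qDG_rhs !(rmorphB, rmorphD) /= !linearZ /= rmorphB /=.
by rewrite !rmorphM.
Qed.

Lemma qOnsager_AB : qDG_lhs q A B = qDG_rhs q A B.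
Proof.
apply/eqP; rewrite -subr_eq0; apply/eqP.
rewrite -(qDG_morph (quot_proj (qOnsager_ideal q))).
by apply/quot_proj_eq0; exact: QO_relAB.
Qed.

Lemma qOnsager_BA : qDG_lhs q B A = qDG_rhs q B A.
Proof.
apply/eqP; rewrite -subr_eq0; apply/eqP.
rewrite -(qDG_morph (quot_proj (qOnsager_ideal q))).
by apply/quot_proj_eq0; exact: QO_relBA.
Qed.

Lemma qOnsager_ind (P : qOnsager q -> Prop) :
    P 1 -> (forall X, P X -> P (A * X)) -> (forall X, P X -> P (B * X)) ->
    (forall k X Y, P X -> P Y -> P (k *: X + Y)) ->
  forall X, P X.
Proof.
move=> P1 PA PB PD X; have [x <-] := quot_projP X.
have Pw (w : seq bool) :
    P (quot_proj (qOnsager_ideal q) (<< FMonom w >> : freeAB F)).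
  elim: w => [|c w IHw].
    have -> : (<< FMonom [::] >> : freeAB F) = 1 by rewrite -fmoneE.
    by rewrite rmorph1.
  have -> : (<< FMonom (c :: w) >> : freeAB F) =
      (if c then freeA else freeB) * << FMonom w >>.
    have -> : (if c then freeA else freeB) = << fmu c >> :> freeAB F by case: c.
    by rewrite [RHS]fgmulUU mulr1 /mmul /= fmuE fmmulE.
  by rewrite rmorphM; case: c; [exact: PA | exact: PB].
have -> : x = \sum_(w <- msupp x) mcoeff w x *: (<< w >> : freeAB F).
  rewrite {1}[x]monalgE; apply: eq_bigr => w _.
  by apply/malgP => v; rewrite [RHS]mcoeffZ !mcoeffU mulrnAr mulr1.
rewrite raddf_sum /=; elim: (msupp x : seq _) => [|w s IHs].
  by rewrite big_nil -(addNr 1) -scaleN1r; exact: PD.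
by rewrite big_cons linearZ_LR; apply: PD => //; case: w => w; exact: Pw.
Qed.

End QOnsagerGenerators.

(* A left module over an algebra O, on a finite-dimensional space V, is given
   by the linear map rho sending an element of O to its action on V. *)
Definition is_representation (F : fieldType) (O : algType F) (V : vectType F)
    (rho : {linear O -> 'End(V)}) : Prop :=
  rho 1 = \1%VF /\ forall X Y, rho (X * Y) = (rho X \o rho Y)%VF.

Definition irreducible_rep (F : fieldType) (O : algType F) (V : vectType F)
    (rho : {linear O -> 'End(V)}) : Prop :=
  {:V}%VS <> 0%VS /\
  forall W : {vspace V}, (forall X, (rho X @: W <= W)%VS) ->
    W = 0%VS \/ W = {:V}%VS.

Definition diagonalizable_lfun (F : fieldType) (V : vectType F)
    (f : 'End(V)) : Prop :=
  exists2 e : seq V, basis_of {:V} e &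
    forall v, v \in e -> exists c, f v = c *: v.

Definition is_Lusztig (F : fieldType) (q : F)
    (L : {lrmorphism qOnsager q -> qOnsager q}) : Prop :=
  let A := qOA q in
  let B := qOB q in
  let c := ((q - q^-1) * (q ^+ 2 - q ^- 2))^-1 in
  exists Li : qOnsager q -> qOnsager q,
    [/\ cancel L Li, cancel Li L,
        L A = A /\
        L B = B + c *: (q *: (A ^+ 2 * B) - (q + q^-1) *: (A * B * A)
                        + q^-1 *: (B * A ^+ 2)) &
        Li A = A /\
        Li B = B + c *: (q^-1 *: (A ^+ 2 * B) - (q + q^-1) *: (A * B * A)
                         + q *: (B * A ^+ 2))].

Definition standard_ordering (F : fieldType) (V : vectType F) (f g : 'End(V))
    (d : nat) (theta : 'I_d.+1 -> F) : Prop :=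
  [/\ injective theta,
      forall c, passmx.leigenvalue f c <-> exists i, c = theta i &
      forall i : 'I_d.+1,
        (g @: passmx.leigenspace f (theta i)
          <= \sum_(j < d.+1 | (j <= i.+1)%N && (i <= j.+1)%N)
               passmx.leigenspace f (theta j))%VS].

(* daddv_pi U W is the projection onto U along W when U and W are in direct
   sum, as the eigenspaces are here. *)
Definition eigenproj (F : fieldType) (V : vectType F) (f : 'End(V))
    (d : nat) (theta : 'I_d.+1 -> F) (i : 'I_d.+1) : 'End(V) :=
  daddv_pi (passmx.leigenspace f (theta i))
           (\sum_(j < d.+1 | j != i) passmx.leigenspace f (theta j))%VS.

Definition Psi (F : fieldType) (q a : F) (V : vectType F) (f : 'End(V))
    (d : nat) (theta : 'I_d.+1 -> F) : 'End(V) :=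
  \sum_(i < d.+1) (a ^+ (2 * i) * q ^+ (2 * i * (d - i))) *: eigenproj f theta i.

(* Main.v *)
Require Import Defs.
From mathcomp Require Import all_boot all_algebra.
From mathcomp Require Import ring zify.
Set Implicit Arguments.
Unset Strict Implicit.
Unset Printing Implicit Defensive.
Import GRing.Theory.
Local Open Scope ring_scope.

(** The whole statement reduces to a scalar identity.  Both
    [X |-> rho (L X)] and [X |-> Psi^-1 rho X Psi] are algebra maps, so it
    suffices to compare them on the two generators, in the form
    [Psi rho (L X) = rho X Psi], which needs no inverse and propagates from
    letters to words.

    On the generator A this holds because Psi is diagonal on the eigenspaces of
    A.  For the generator B, let v be an eigenvector of A for theta_j and let
    w be the component of B v in the eigenspace for theta_k.  Every word
    occurring in L(B) contains B exactly once, surrounded by powers of A, so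
    the component of L(B) v in that eigenspace is w times
      [1 + (q theta_k^2 - (q + q^-1) theta_k theta_j + q^-1 theta_j^2)
             / ((q - q^-1) (q^2 - q^-2))].
    The quadratic form factors as
    [(theta_k - theta_j) (q theta_k - q^-1 theta_j)], and for the q-Racah
    eigenvalues [theta_i = x_i + x_i^-1] with [x_i = a q^(d - 2i)] the scalar
    collapses, when k and j differ by at most 1, to [t_j / t_k]
    ([Lusztig_coef_ratio]).  Since A and B form a tridiagonal pair, no other
    components occur, so Psi L(B) v = t_j B v = B Psi v ([Psi_Lusztig_B]).

    As A is diagonalizable, its eigenspaces span V; hence it is enough to
    check these identities on eigenvectors, and Psi, whose scalars t_i are
    nonzero, is invertible. *)

(** * Diagonal maps on a sum of eigenspaces *)

Section SpectralMap.
Variables (F : fieldType) (V : vectType F) (f : 'End(V)).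
Variables (d : nat) (theta : 'I_d.+1 -> F).
Hypothesis theta_inj : injective theta.
Local Notation E i := (passmx.leigenspace f (theta i)).

Lemma sub_scalar_lfunE c v : (f - c *: \1)%VF v = f v - c *: v.
Proof. by rewrite add_lfunE opp_lfunE scale_lfunE id_lfunE. Qed.

Lemma memv_leigenspace c v :
  reflect (f v = c *: v) (v \in passmx.leigenspace f c).
Proof. by rewrite memv_ker sub_scalar_lfunE subr_eq0; exact: eqP. Qed.

(** The product of the [f - theta j] over j in s acts on each eigenspace by a
    scalar; taken over all j different from i it kills the other eigenspaces
    while remaining injective on the i-th one. *)
Lemma leigenspace_direct i :
  (E i :&: \sum_(j < d.+1 | j != i) E j = 0)%VS.
Proof.
pose g s := foldr (fun j h => (f - theta j *: \1) \o h)%VF \1%VF s.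
have gE s k v : v \in E k -> g s v = (\prod_(j <- s) (theta k - theta j)) *: v.
  move=> /memv_leigenspace fv; elim: s => [|j s IHs] /=.
    by rewrite big_nil lfunE scale1r.
  rewrite comp_lfunE IHs sub_scalar_lfunE linearZ /= fv big_cons.
  by rewrite !scalerA -scalerBl; congr (_ *: _); ring.
apply/eqP; rewrite -subv0; apply/subvP => v.
rewrite memv_cap memv0 => /andP[Ev /memv_sumP[w Ew v_sum]].
have gv0 : g (enum (predC1 i)) v = 0.
  rewrite v_sum linear_sum big1 // => j ji /=.
  rewrite (gE _ j) ?Ew // (big_rem j) ?mem_enum //=.
  by rewrite subrr mul0r scale0r.
move/eqP: gv0; rewrite (gE _ i) // scaler_eq0 => /orP[|//].
rewrite prodf_seq_eq0 => /hasP[j]; rewrite mem_enum /= => ji.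
by rewrite subr_eq0 (inj_eq theta_inj) eq_sym (negPf ji).
Qed.

Lemma eigenproj_leigenspace i j v :
  v \in E j -> eigenproj f theta i v = if i == j then v else 0.
Proof.
rewrite /eigenproj; case: eqP => [-> Ev | /eqP ij Ev].
  by rewrite daddv_pi_id // leigenspace_direct.
have Wv : v \in (\sum_(k < d.+1 | k != i) E k)%VS.
  by apply: (subvP (sumv_sup j _ (subvv _))) => //; rewrite eq_sym.
have := daddv_pi_add (leigenspace_direct i) (subvP (addvSr _ _) _ Wv).
rewrite [X in _ + X]daddv_pi_id // ?(capvC _ (E i)) ?leigenspace_direct //.
by move/(canRL (addrK v)); rewrite subrr.
Qed.

Lemma spectral_mapE (t : 'I_d.+1 -> F) j v :
  v \in E j -> (\sum_(i < d.+1) t i *: eigenproj f theta i) v = t j *: v.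
Proof.
move=> Ev; rewrite sum_lfunE (bigD1 j) //= lfunE /=.
rewrite (eigenproj_leigenspace _ Ev) eqxx big1 ?addr0 // => i ij.
by rewrite lfunE /= (eigenproj_leigenspace _ Ev) (negPf ij) scaler0.
Qed.

Hypothesis f_diag : diagonalizable_lfun f.
Hypothesis theta_all :
  forall c, passmx.leigenvalue f c <-> exists i, c = theta i.

Lemma sum_leigenspace : (\sum_(i < d.+1) E i = fullv)%VS.
Proof.
have [e e_basis e_eig] := f_diag.
apply/eqP; rewrite eqEsubv subvf /= -(span_basis e_basis).
apply/span_subvP => v ev.
have [c fv] := e_eig v ev.
have Ev : v \in passmx.leigenspace f c by apply/memv_leigenspace.
have v0 : v != 0 := free_not0 (basis_free e_basis) ev.
have [|i ci] := (theta_all c).1 _.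
  apply: contra v0 => /eqP E0; by move: Ev; rewrite E0 memv0.
by rewrite ci in Ev; apply: (subvP (sumv_sup i _ (subvv _))).
Qed.

Lemma eq_lfun_leigenspace (g h : 'End(V)) :
  (forall j v, v \in E j -> g v = h v) -> g = h.
Proof.
move=> gh; apply/lfunP => v.
have: v \in (\sum_(i < d.+1) E i)%VS by rewrite sum_leigenspace memvf.
case/memv_sumP => w Ew ->; rewrite !linear_sum.
by apply: eq_bigr => i _; apply: (gh i); exact: Ew.
Qed.

(** The map with the inverse coefficients is a left inverse. *)
Lemma lker_spectral_map (t : 'I_d.+1 -> F) : (forall i, t i != 0) ->
  lker (\sum_(i < d.+1) t i *: eigenproj f theta i) == 0%VS.
Proof.
move=> t_neq0; set D := \sum_(i < _) _.
pose D' := \sum_(i < d.+1) (t i)^-1 *: eigenproj f theta i.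
have D'D : (D' \o D = \1)%VF.
  apply: eq_lfun_leigenspace => j v Ev.
  rewrite !lfunE /= (spectral_mapE _ Ev) linearZ /= (spectral_mapE _ Ev).
  by rewrite scalerA mulfV // scale1r.
rewrite -subv0; apply/subvP => v; rewrite memv_ker memv0 => /eqP Dv.
by rewrite -[v]id_lfunE -D'D comp_lfunE Dv linear0.
Qed.

End SpectralMap.

(** * The scalar identity *)

Section Scalars.
Variables (F : fieldType) (q a : F).
Hypotheses (q_neq0 : q != 0) (a_neq0 : a != 0).
Hypothesis q_not_root : forall n : nat, (0 < n)%N -> q ^+ n != 1.
Variable d : nat.

(** The scalar by which the component for the eigenvalue x of B v is multiplied
    in L(B) v, when v is an eigenvector of A for y. *)
Definition Lusztig_coef (x y : F) : F :=
  1 + ((q - q^-1) * (q ^+ 2 - q ^- 2))^-1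
      * (q * x ^+ 2 - (q + q^-1) * x * y + q^-1 * y ^+ 2).

Definition qRacah (i : nat) : F :=
  a * q ^ (d%:Z - 2 * i%:Z) + a^-1 * q ^ (2 * i%:Z - d%:Z).

Definition Psi_coef (i : nat) : F := a ^+ (2 * i) * q ^+ (2 * i * (d - i)).

Lemma Psi_coef_neq0 i : Psi_coef i != 0.
Proof. by rewrite mulf_neq0 // expf_neq0. Qed.

Lemma Lusztig_coef_diag x : Lusztig_coef x x = 1.
Proof. by rewrite /Lusztig_coef; ring. Qed.

(** The quadratic form in [Lusztig_coef] at u and v is the product of
    [u - v] and [q u - q^-1 v].  At these two arguments the factors equal
    [(q - q^-1) (x q^-1 - x^-1 q)] and [(q^2 - q^-2) x q^-1], which cancels the
    denominator; that denominator is nonzero because [q^2] and [q^4] differ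
    from 1. *)
Lemma Lusztig_coef_step x : x != 0 ->
  Lusztig_coef (x + x^-1) (x * q ^- 2 + x^-1 * q ^+ 2) = x ^+ 2 * q ^- 2.
Proof.
move=> x0; have q2 : q ^+ 2 - 1 != 0 by rewrite subr_eq0 q_not_root.
have q4 : q ^+ 4 - 1 != 0 by rewrite subr_eq0 q_not_root.
rewrite /Lusztig_coef; field.
by rewrite -[q * q]expr2 -exprM q_neq0 x0 q4 q2.
Qed.

Lemma qRacahE i : qRacah i =
  a * q ^ (d%:Z - 2 * i%:Z) + (a * q ^ (d%:Z - 2 * i%:Z))^-1.
Proof. by rewrite /qRacah invfM invr_expz opprB. Qed.

Lemma qRacahS i : qRacah i.+1 =
  a * q ^ (d%:Z - 2 * i%:Z) * q ^- 2
  + (a * q ^ (d%:Z - 2 * i%:Z))^-1 * q ^+ 2.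
Proof.
have -> : a * q ^ (d%:Z - 2 * i%:Z) * q ^- 2 = a * q ^ (d%:Z - 2 * i.+1%:Z).
  rewrite -mulrA; congr (_ * _).
  by rewrite exprnN -expfzDr //; congr (q ^ _); lia.
rewrite qRacahE; congr (_ + _); rewrite !invfM -mulrA; congr (_ * _).
by rewrite !invr_expz [q ^+ 2]exprnP -expfzDr //; congr (q ^ _); lia.
Qed.

Lemma Psi_coefS i : (i < d)%N ->
  Psi_coef i.+1 = Psi_coef i * ((a * q ^ (d%:Z - 2 * i%:Z)) ^+ 2 * q ^- 2).
Proof.
move=> id; set z := (d%:Z - _).
have Eq : q ^+ (2 * i.+1 * (d - i.+1)) =
    q ^+ (2 * i * (d - i)) * ((q ^ z) ^+ 2 * q ^- 2).
  rewrite exprnN !exprnP exprz_exp -!expfzDr //; congr (q ^ _).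
  rewrite /z; nia.
rewrite /Psi_coef Eq exprMn mulnS exprD.
by set W := q ^- 2; set Z := (q ^ z) ^+ 2; ring.
Qed.

(** Since [x_(k+1) = x_k q^-2], the case j = k + 1 is [Lusztig_coef_step] at
    [x_k].  Since [x_(k-1)^-1 = x_k^-1 q^-2], the case j = k - 1 is the same
    identity at [x_k^-1]: inverting x only swaps the two summands of
    [x + x^-1]. *)
Lemma Lusztig_coef_ratio k j : (k <= d)%N -> (j <= d)%N ->
    (k <= j.+1)%N -> (j <= k.+1)%N ->
  Psi_coef k * Lusztig_coef (qRacah k) (qRacah j) = Psi_coef j.
Proof.
move=> kd jd kj jk.
have x0 i : a * q ^ (d%:Z - 2 * i%:Z) != 0 by rewrite mulf_neq0 // expfz_neq0.
have [<-|kNj] := eqVneq k j; first by rewrite Lusztig_coef_diag mulr1.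
have [jS | jS] := eqVneq j k.+1.
  by rewrite jS qRacahS qRacahE Lusztig_coef_step // Psi_coefS // -jS.
have kS : k = j.+1 by lia.
rewrite kS qRacahS qRacahE; set x := a * _; have {}x0 : x != 0 := x0 j.
(* x belongs to j, so y is the inverse of the parameter belonging to k. *)
pose y := x^-1 * q ^+ 2.
have y0 : y != 0 by rewrite mulf_neq0 ?invr_eq0 ?expf_neq0.
have -> : x * q ^- 2 + x^-1 * q ^+ 2 = y + y^-1.
  by rewrite /y invfM invrK addrC.
have -> : x + x^-1 = y * q ^- 2 + y^-1 * q ^+ 2.
  by rewrite /y; field; rewrite x0 q_neq0.
rewrite Lusztig_coef_step // Psi_coefS -/x; last by lia.
by rewrite /y; field; rewrite x0 q_neq0.
Qed.

End Scalars.

(** * The Lusztig automorphism on a representation *)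

Section Conjugation.
Variables (F : fieldType) (q : F) (V : vectType F).
Variable rho : {linear qOnsager q -> 'End(V)}.
Hypothesis rho_rep : is_representation rho.
Local Notation A := (qOA q).
Local Notation B := (qOB q).

Lemma rho_mulE X Y v : rho (X * Y) v = rho X (rho Y v).
Proof. by rewrite rho_rep.2 comp_lfunE. Qed.

Section Intertwining.
Variable L : {lrmorphism qOnsager q -> qOnsager q}.
Variable P : 'End(V).
Hypothesis PA : (P \o rho (L A) = rho A \o P)%VF.
Hypothesis PB : (P \o rho (L B) = rho B \o P)%VF.

(** The set of X satisfying the conclusion is a subalgebra, so it is everything
    as soon as it contains A and B. *)
Lemma intertwine_generators X : (P \o rho (L X) = rho X \o P)%VF.
Proof.
elim/qOnsager_ind: X => [|X IHX|X IHX|k X Y IHX IHY].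
- by rewrite rmorph1 rho_rep.1 comp_lfun1l comp_lfun1r.
- by rewrite rmorphM !rho_rep.2 comp_lfunA PA -!comp_lfunA IHX.
- by rewrite rmorphM !rho_rep.2 comp_lfunA PB -!comp_lfunA IHX.
- rewrite !linearP comp_lfunDl comp_lfunDr -comp_lfunZl -comp_lfunZr.
  by rewrite IHX IHY.
Qed.

End Intertwining.

Variables (d : nat) (theta : 'I_d.+1 -> F) (a : F).
Hypotheses (q_neq0 : q != 0) (a_neq0 : a != 0).
Hypothesis q_not_root : forall n : nat, (0 < n)%N -> q ^+ n != 1.
Hypothesis A_diag : diagonalizable_lfun (rho A).
Hypothesis theta_std : standard_ordering (rho A) (rho B) theta.
Hypothesis theta_eq : forall i : 'I_d.+1, theta i = qRacah q a d i.

Local Notation E i := (passmx.leigenspace (rho A) (theta i)).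
Local Notation P := (Psi q a (rho A) theta).

Lemma theta_inj : injective theta. Proof. by case: theta_std. Qed.

Lemma Psi_leigenspace j v : v \in E j -> P v = Psi_coef q a d j *: v.
Proof. exact: (spectral_mapE theta_inj (Psi_coef q a d)). Qed.

Lemma Psi_A : (P \o rho A = rho A \o P)%VF.
Proof.
have [_ theta_all _] := theta_std.
apply: (eq_lfun_leigenspace A_diag theta_all) => j v Ev.
have /memv_leigenspace Av := Ev.
rewrite !comp_lfunE (Psi_leigenspace Ev) Av !linearZ /= (Psi_leigenspace Ev) Av.
by rewrite !scalerA mulrC.
Qed.

(** On an eigenvector v of A, both sides expand over the components of B v in
    the eigenspaces adjacent to that of v, and [Lusztig_coef_ratio] matches the
    coefficients component by component. *)
Lemma Psi_Lusztig_B (LB : qOnsager q) :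
    LB = B + ((q - q^-1) * (q ^+ 2 - q ^- 2))^-1 *:
      (q *: (A ^+ 2 * B) - (q + q^-1) *: (A * B * A) + q^-1 *: (B * A ^+ 2)) ->
  (P \o rho LB = rho B \o P)%VF.
Proof.
move=> LBE; have [_ theta_all BE] := theta_std.
apply: (eq_lfun_leigenspace A_diag theta_all) => j v Ev.
have /memv_leigenspace Av := Ev.
rewrite !comp_lfunE (Psi_leigenspace Ev) linearZ /=.
have /memv_sumP[w Ew Bv] := subvP (BE j) _ (memv_img (rho B) Ev).
have -> : rho LB v = \sum_(k < d.+1 | (k <= j.+1)%N && (j <= k.+1)%N)
    Lusztig_coef q (theta k) (theta j) *: w k.
  have rhoD Y Z u : rho (Y + Z) u = rho Y u + rho Z u.
    by rewrite linearD add_lfunE.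
  have rhoN Y u : rho (- Y) u = - rho Y u by rewrite linearN opp_lfunE.
  have rhoZ k Y u : rho (k *: Y) u = k *: rho Y u.
    by rewrite linearZ scale_lfunE.
  have A_sum (c : 'I_d.+1 -> F) :
      rho A (\sum_(k < d.+1 | (k <= j.+1)%N && (j <= k.+1)%N) c k *: w k) =
      \sum_(k < d.+1 | (k <= j.+1)%N && (j <= k.+1)%N) (theta k * c k) *: w k.
    rewrite linear_sum; apply: eq_bigr => k /Ew /memv_leigenspace Aw.
    by rewrite linearZ /= Aw scalerA mulrC.
  (* The coefficient 1 makes the sum an instance of A_sum. *)
  have {}Bv : rho B v =
      \sum_(k < d.+1 | (k <= j.+1)%N && (j <= k.+1)%N) 1 *: w k.
    by rewrite Bv; apply: eq_bigr => k _; rewrite scale1r.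
  have ABA : rho A (rho B (rho A v)) = theta j *: rho A (rho B v).
    by rewrite Av !linearZ.
  have BAA : rho B (rho A (rho A v)) = theta j ^+ 2 *: rho B v.
    by rewrite Av linearZ /= Av scalerA linearZ.
  rewrite LBE !expr2 !(rhoD, rhoN, rhoZ, rho_mulE) BAA ABA Bv !A_sum.
  rewrite !scaler_sumr -sumrB -big_split scaler_sumr -big_split /=.
  apply: eq_bigr => k _.
  rewrite !scalerA -scalerBl -!scalerDl scalerA -scalerDl /Lusztig_coef.
  by congr (_ *: _); ring.
rewrite Bv linear_sum scaler_sumr; apply: eq_bigr => k /[dup] Pk /andP[kj jk].
rewrite linearZ /= (Psi_leigenspace (Ew k Pk)) scalerA mulrC !theta_eq.
by rewrite Lusztig_coef_ratio // -ltnS ltn_ord.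
Qed.

End Conjugation.

Theorem theorem8p6 (F : fieldType) (q : F)
  (q_neq0 : q != 0)
  (q_not_root : forall n : nat, (0 < n)%N -> q ^+ n != 1)
  (L : {lrmorphism qOnsager q -> qOnsager q})
  (L_Lusztig : is_Lusztig L)
  (V : vectType F)
  (rho : {linear qOnsager q -> 'End(V)})
  (rho_rep : is_representation rho)
  (rho_irr : irreducible_rep rho)
  (dimV_ge2 : (2 <= \dim {:V})%N)
  (A_diag : diagonalizable_lfun (rho (qOA q)))
  (B_diag : diagonalizable_lfun (rho (qOB q)))
  (d : nat) (theta : 'I_d.+1 -> F)
  (theta_std : standard_ordering (rho (qOA q)) (rho (qOB q)) theta)
  (a : F) (a_neq0 : a != 0)
  (theta_eq : forall i : 'I_d.+1,
     theta i = a * q ^ (d%:Z - 2 * i%:Z) + a^-1 * q ^ (2 * i%:Z - d%:Z))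
  (X : qOnsager q) :
  let P := Psi q a (rho (qOA q)) theta in
  rho (L X) = (P^-1 \o rho X \o P)%VF.
Proof.
move=> P; have [Li [_ _ [LA LB] _]] := L_Lusztig.
have [theta_inj theta_all _] := theta_std.
have intertwine : (P \o rho (L X) = rho X \o P)%VF.
  apply: intertwine_generators => //; first by rewrite LA; exact: Psi_A.
  exact: (Psi_Lusztig_B rho_rep q_neq0 a_neq0 q_not_root A_diag theta_std).
have P_inj : lker P == 0%VS.
  apply: (lker_spectral_map theta_inj A_diag theta_all
            (t := fun i => Psi_coef q a d i)) => i.
  exact: Psi_coef_neq0.
by rewrite -comp_lfunA -intertwine lker0_compKf.
Qed.
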